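(* For $n\ge1$, let $P_n^{n}$ denote the path on $n$ vertices on which $n$ chips are placed, each chip independently and uniformly at random on one of the $n$ vertices (the weight of a vertex being its number of chips), and let $P_n^{\mathrm{Poi}}$ denote the path on $n$ vertices in which each vertex independently receives a $\mathrm{Poi}(1)$ weight. Let $A_t(\cdot)$ denote the total acquisition number. Then $\lim_{n\to\infty} E\big(A_t(P_n^{n})\big)/n$ exists and $$\lim_{n\to\infty}\frac{E\big(A_t(P_n^{n})\big)}{n} = \lim_{n\to\infty}\frac{E\big(A_t(P_n^{\mathrm{Poi}})\big)}{n}.$$
   Context: Let $G$ be a graph whose vertices carry nonnegative integer weights $w(v)$. An acquisition move consists of choosing adjacent vertices $u,v$ with current weights satisfying $w(u)\ge w(v)>0$ and transferring all of the weight of $v$ to $u$. A sequence of acquisition moves after which no further move is possible is an acquisition protocol; the set of vertices with nonzero weight at its end is the residual set. The total acquisition number $a_t(G)$ is the minimum size of a residual set over all acquisition protocols. (The limit on the right-hand side is known to exist.) *)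

(* Defs.v *)
From HB Require Import structures.
From mathcomp Require Import all_boot all_order all_algebra.
From mathcomp Require Import all_classical all_reals all_analysis.
Import Order.TTheory GRing.Theory Num.Theory.

Set Implicit Arguments.
Unset Strict Implicit.
Unset Printing Implicit Defensive.

Record sgraph := SGraph {
  vertex :> finType;
  edge : rel vertex;
  edge_sym : symmetric edge;
  edge_irr : irreflexive edge }.

Definition weighting (G : sgraph) := {ffun G -> nat}.

Section Acquisition.
Variable G : sgraph.
Implicit Types (w : weighting G) (u v : G).

(* The vertex u may acquire the weight of its neighbour v. *)
Definition legal_move w u v := [&& edge u v, 0 < w v & w v <= w u].

Definition make_move w u v : weighting G :=
  [ffun x => if x == u then w u + w v else if x == v then 0 else w x].

Definition acq_step : rel (weighting G) := fun w w' =>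
  [exists u, exists v, legal_move w u v && (w' == make_move w u v)].

Definition stuck w := ~~ [exists u, exists v, legal_move w u v].

(* The sequence s lists the weightings obtained after each successive move. *)
Definition acq_protocol w (s : seq (weighting G)) :=
  path acq_step w s && stuck (last w s).

Definition residual_set w (s : seq (weighting G)) : {set G} :=
  [set v | 0 < last w s v].

Definition residual_size w (k : nat) : Prop :=
  exists2 s, acq_protocol w s & #|residual_set w s| = k.

Lemma make_move_support w u v : legal_move w u v ->
  #|[set x | 0 < make_move w u v x]| < #|[set x | 0 < w x]|.
Proof.
move=> /and3P[euv wv wvu]; apply: proper_card; apply/properP.
have uv : v != u by apply: contraTneq euv => ->; rewrite edge_irr.
split.
  apply/fintype.subsetP => x; rewrite !inE /make_move ffunE.
  have [-> _|_] := eqVneq x u; first exact: leq_trans wv wvu.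
  by have [|] := eqVneq x v.
by exists v; rewrite !inE /make_move ?ffunE // ?ffunE (negbTE uv) eqxx.
Qed.

Lemma acq_protocol_exists w : exists s, acq_protocol w s.
Proof.
move: {2}_.+1 (ltnSn #|[set x | 0 < w x]|) => n.
elim: n w => // n IH w; rewrite ltnS => wn.
have [/existsP[u /existsP[v uv]]|st] :=
    boolP [exists u, exists v, legal_move w u v]; last first.
  by exists [::].
have [s /andP[ps sts]] :=
  IH (make_move w u v) (leq_trans (make_move_support uv) wn).
exists (make_move w u v :: s); rewrite /acq_protocol /= ps sts !andbT.
by apply/existsP; exists u; apply/existsP; exists v; rewrite uv eqxx.
Qed.

Lemma residual_size_exists w : exists k, `[< residual_size w k >].
Proof.
have [s ps] := acq_protocol_exists w.
by exists #|residual_set w s|; apply/asboolP; exists s.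
Qed.

Definition total_acquisition w : nat := ex_minn (residual_size_exists w).

End Acquisition.

Definition path_edge n : rel 'I_n :=
  fun i j => (i.+1 == j :> nat) || (j.+1 == i :> nat).

Lemma path_edge_sym n : symmetric (@path_edge n).
Proof. by move=> i j; rewrite /path_edge orbC. Qed.

Lemma path_edge_irr n : irreflexive (@path_edge n).
Proof. by move=> i; rewrite /path_edge orbb gtn_eqF. Qed.

Definition path_graph n : sgraph :=
  SGraph (@path_edge_sym n) (@path_edge_irr n).

Definition chip_weighting n m (c : 'I_m -> 'I_n) : weighting (path_graph n) :=
  [ffun v => #|[set i | c i == v]|].

HB.instance Definition _ (n : nat) := isPointed.Build 'I_n.+1 ord0.
HB.instance Definition _ (n : nat) := @isMeasurable.Build
  default_measure_display 'I_n.+1 discrete_measurable discrete_measurable0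
  discrete_measurableC discrete_measurableU.

Section RandomVariables.
Local Open Scope classical_set_scope.
Local Open Scope ereal_scope.
Context {d} {T : measurableType d} {R : realType} (P : probability T R).

Definition mutually_independent {d'} {T' : measurableType d'} (I : finType)
    (X : I -> {RV P >-> T'}) : Prop :=
  forall (J : {set I}) (B : I -> set T'),
    (forall i, i \in J -> measurable (B i)) ->
    P (\bigcap_(i in [set` J]) (X i @^-1` B i)) =
    \prod_(i in J) P (X i @^-1` B i).

Definition uniformly_distributed n (X : {RV P >-> 'I_n.+1}) : Prop :=
  forall k, P (X @^-1` [set k]) = (n.+1%:R^-1)%:E.

Definition poisson_distributed (rate : R) (X : {RV P >-> nat}) : Prop :=
  forall k, P (X @^-1` [set k]) = (poisson_pmf rate k)%:E.

Definition expected_acquisition (G : sgraph) (w : T -> weighting G) : \bar R :=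
  'E_P[fun t => (total_acquisition (w t))%:R%R].

End RandomVariables.

(* Main.v *)
Require Import Defs.
From HB Require Import structures.
From mathcomp Require Import all_boot all_order all_algebra.
From mathcomp Require Import all_classical all_reals all_analysis.
From mathcomp Require Import measurable_realfun.
From mathcomp Require Import ring lra.
Import Order.TTheory GRing.Theory Num.Theory numFieldNormedType.Exports.

Set Implicit Arguments.
Unset Strict Implicit.
Unset Printing Implicit Defensive.

(* Concatenating protocols shows that A_t is subadditive on paths, so Fekete's
   lemma gives the limit in the Poisson model.  Changing the weight of a single
   vertex of a path changes A_t by at most 3, so the mean g m of A_t over
   placements of m chips is 3-Lipschitz in m.  Conditioned on its total m, the
   Poisson weighting is a uniform placement of m chips, and the total is
   Poi(n); hence the two expectations are E g(Poi(n)) and g n, which differ by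
   at most 3 E|Poi(n) - n| <= 3 sqrt n = o(n). *)

(** * Total acquisition under local changes and concatenation *)

(** Lowering one weight can forbid a move on which an optimal protocol relies, so protocols cannot
    simply be replayed after a change. The deficit is instead followed along the protocol: it always
    sits at a single vertex, and a move fails only when that vertex can no longer acquire a
    neighbour. As degrees are at most 2, at most two vertices are lost in this way. The constant 3
    comes from passing through the weighting with the changed vertex erased: erasing costs at most
    2, and restoring the vertex costs at most 1.

    Fekete is applied to the Poisson model because the restriction of independent weights to a
    subpath is again a model of the same kind; in the uniform model the numbers of chips on two
    complementary subpaths are tied by their sum. *)

Section Reachability.
Variable G : sgraph.
Implicit Types (w s z : weighting G) (u v x y : G).

Definition nsupp w := #|[set v | 0 < w v]|.

Inductive reach w : weighting G -> Prop :=
| reach_refl : reach w w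
| reach_move s u v : reach w s -> legal_move s u v ->
    reach w (make_move s u v).

Lemma reach_trans w s z : reach w s -> reach s z -> reach w z.
Proof. by move=> ws; elim=> // z' u v _; exact: reach_move. Qed.

Lemma legal_move_neq w u v : legal_move w u v -> u != v.
Proof. by case/and3P=> uv _ _; apply: contraTneq uv => ->;
  rewrite edge_irr. Qed.

Lemma reach_pathP w s :
  reach w s <-> exists2 p, path (@acq_step G) w p & last w p = s.
Proof.
split=> [|[p]].
  elim=> [|z u v _ [p wp pz] zuv]; first by exists [::].
  exists (rcons p (make_move z u v)); last by rewrite last_rcons.
  rewrite rcons_path wp pz; apply/existsP; exists u; apply/existsP; exists v.
  by rewrite zuv eqxx.
elim/last_ind: p s => [|p z IH] s; first by move=> _ <-; exact: reach_refl.
rewrite rcons_path last_rcons => /andP[wp /existsP[u /existsP[v /andP[uv /eqP zE]]]] <-.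
by rewrite zE; apply: reach_move uv; exact: IH.
Qed.

Lemma nsupp_reach w s : reach w s -> nsupp s <= nsupp w.
Proof.
elim=> // z u v _ zw zuv; apply: leq_trans zw; apply: ltnW.
exact: make_move_support.
Qed.

(** A run may stop anywhere: completing it to a protocol never enlarges the support. Upper bounds
    therefore need no check that the final weighting is stuck. *)
Lemma total_acquisition_le w s : reach w s -> total_acquisition w <= nsupp s.
Proof.
move=> ws; have [p /andP[sp st]] := acq_protocol_exists s.
apply: leq_trans (nsupp_reach _); last by apply/reach_pathP; exists p.
rewrite /total_acquisition; case: ex_minnP => k _; apply.
have /reach_pathP[q wq qs] := ws.
by apply/asboolP; exists (q ++ p);
  rewrite /acq_protocol /residual_set ?cat_path last_cat qs // wq sp.
Qed.

Lemma total_acquisition_reach w :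
  exists2 s, reach w s & nsupp s = total_acquisition w.
Proof.
rewrite /total_acquisition; case: ex_minnP => k /asboolP[p /andP[wp _] pk] _.
by exists (last w p) => //; apply/reach_pathP; exists p.
Qed.

Lemma total_acquisition_card w : total_acquisition w <= #|G|.
Proof.
exact: leq_trans (total_acquisition_le (reach_refl w)) (max_card _).
Qed.

Lemma make_move_gt0 w u v x :
  legal_move w u v -> 0 < make_move w u v x -> 0 < w x.
Proof.
case/and3P=> _ v0 vu; rewrite ffunE; have [->|_] := eqVneq x u.
  by rewrite (leq_trans v0 vu).
by case: eqP.
Qed.

(** A vertex of weight 0 can neither acquire nor be acquired, so a run from [w'] never involves [v]
    and can be replayed from [w]. Only [v] itself may be left over in addition. *)
Lemma total_acquisition_add_vertex v w w' :
  {in predC1 v, w' =1 w} -> w' v = 0 ->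
  total_acquisition w <= (total_acquisition w').+1.
Proof.
move=> w'w w'v; have [z w'z <-] := total_acquisition_reach w'.
have [s [ws sz zv]] : exists s, [/\ reach w s, {in predC1 v, z =1 s} & z v = 0].
  elim: w'z => [|{}z a b _ [s [ws sz zv]] zab].
    by exists w; split=> //; exact: reach_refl.
  have av : a != v.
    by apply: contraTneq zab => ->; rewrite /legal_move zv lt0n leqn0;
      case: eqP; rewrite ?andbF.
  have bv : b != v by apply: contraTneq zab => ->; rewrite /legal_move zv andbF.
  exists (make_move s a b); split.
  - by apply: reach_move => //; move: zab; rewrite /legal_move !sz.
  - by move=> y yv; rewrite !ffunE !sz.
  - by rewrite ffunE eq_sym (negbTE av) eq_sym (negbTE bv).
apply: leq_trans (total_acquisition_le ws) _.
have /subset_leq_card : [set y | 0 < s y] \subset v |: [set y | 0 < z y].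
  apply/fintype.subsetP => y; rewrite !inE; have [//|yv] := eqVneq y v.
  by rewrite sz.
by move=> /leq_trans-> //; rewrite cardsU1; case: (_ \notin _).
Qed.

(** * Cost of lowering one weight when all degrees are at most two *)

Definition live w x := [set y | edge x y & 0 < w y].

Lemma live_move w u v x : legal_move w u v ->
  live (make_move w u v) x \subset live w x.
Proof.
move=> wuv; apply/fintype.subsetP => y; rewrite !inE => /andP[-> /=].
exact: make_move_gt0.
Qed.

Hypothesis deg2 : forall x, #|[set y | edge x y]| <= 2.

(* [s] and [z] differ at most at the carrier [x], where [z] is smaller, and on
   the set [B] of vertices that were acquired in [s] but could not be in [z].
   The live neighbours of the carrier bound the future growth of [B]. *)
Definition dominated s z := exists x (B : {set G}),
  [/\ forall y, y \notin B -> y != x -> z y = s y,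
      forall y, y \in B -> s y = 0, z x <= s x & #|B| + #|live s x| <= 2].

(** The smaller weighting imitates the move whenever it can. A move that acquires the carrier makes
    [u] the new carrier; a move by the carrier that is too weak in [z] abandons [v]. *)
Lemma dominated_move s z u v : dominated s z -> legal_move s u v ->
  exists2 z', reach z z' & dominated (make_move s u v) z'.
Proof.
move=> [x [B [zs B0 zx cB]]] suv; have uv := legal_move_neq suv.
have /and3P[euv sv su] := suv.
have NB y : 0 < s y -> y \notin B by move=> y0; apply: contraL y0 => /B0->.
have vB := NB _ sv; have uB := NB _ (leq_trans sv su).
have cB' : #|B| + #|live (make_move s u v) x| <= 2.
  by apply: leq_trans cB; rewrite leq_add2l subset_leq_card ?live_move.
have B0' y : y \in B -> make_move s u v y = 0.
  move=> yB; have := B0 _ yB; rewrite ffunE.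
  have [yu|_ ->] := eqVneq y u; first by rewrite -yu yB in uB.
  by case: eqP.
have [ux|ux] := eqVneq u x.
  subst u; have zv : z v = s v by rewrite zs // eq_sym.
  have [le|lt] := leqP (z v) (z x).
    exists (make_move z x v).
      by apply: reach_move (reach_refl _) _; rewrite /legal_move euv le zv sv.
    exists x, B; split=> //.
      by move=> y yB yx; rewrite !ffunE (negbTE yx) zs.
    by rewrite !ffunE eqxx leq_add ?zv.
  (* Here [z x < z v], so the move is skipped and [v] joins [B]. This is paid for by [v] ceasing to
     be a live neighbour of the carrier in [s]. *)
  exists z; first exact: reach_refl.
  exists x, (v |: B); split.
  - move=> y; rewrite !inE negb_or => /andP[yv yB] yx.
    by rewrite ffunE (negbTE yx) (negbTE yv) zs.
  - move=> y; rewrite !inE => /orP[/eqP->|]; last exact: B0'.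
    by rewrite ffunE eq_sym (negbTE uv) eqxx.
  - by rewrite ffunE eqxx (leq_trans zx) ?leq_addr.
  - rewrite cardsU1 vB add1n addSn -addnS; apply: leq_trans cB;
      rewrite leq_add2l.
    apply/proper_card/properP; split; first exact: live_move.
    exists v; rewrite !inE ?euv ?sv // ffunE eq_sym (negbTE uv) eqxx.
    by rewrite andbF.
have [vx|vx] := eqVneq v x.
  subst v; have zu : z u = s u by rewrite zs.
  (* The budget survives the change of carrier: [x] is now dead, so [u] has at most one live
     neighbour, whereas [x] had at least one before the move, namely [u]. *)
  have cB1 : #|B| + #|live (make_move s u x) u| <= 2.
    apply: leq_trans cB; rewrite leq_add2l.
    apply: (@leq_trans 1).
      rewrite -ltnS; apply: (leq_trans _ (deg2 u)).
      apply/proper_card/properP.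
      split; first by apply/fintype.subsetP => y; rewrite !inE => /andP[].
      by exists x; rewrite !inE ?euv // ffunE eq_sym (negbTE uv) eqxx.
    apply/card_gt0P; exists u; rewrite !inE edge_sym euv.
    exact: leq_trans sv su.
  have [z0|z0] := posnP (z x).
    (* If [z x = 0] there is nothing to transfer, and [z] already agrees at [x] with the weighting
       after the move. *)
    exists z; first exact: reach_refl.
    exists u, B; split=> // [y yB yu|].
      by rewrite ffunE (negbTE yu); have [->//|yx] := eqVneq y x; rewrite zs.
    by rewrite ffunE eqxx zu leq_addr.
  exists (make_move z u x).
    apply: reach_move (reach_refl _) _.
    by rewrite /legal_move euv z0 zu (leq_trans zx su).
  exists u, B; split=> // [y yB yu|].
    by rewrite !ffunE (negbTE yu); have [//|yx] := eqVneq y x; rewrite zs.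
  by rewrite !ffunE eqxx zu leq_add2l.
exists (make_move z u v).
  by apply: reach_move (reach_refl _) _; rewrite /legal_move !zs.
exists x, B; split=> // [y yB yx|]; first by rewrite !ffunE !zs.
by rewrite !ffunE !(eq_sym x) (negbTE ux) (negbTE vx).
Qed.

(** Start the domination with carrier [v] and [B] empty; the degree bound gives the initial budget
    2. At the end the support of [z] lies in that of [s] together with [B]. *)
Lemma total_acquisition_decrease v w w' :
  {in predC1 v, w' =1 w} -> w' v <= w v ->
  total_acquisition w' <= (total_acquisition w).+2.
Proof.
move=> w'w w'v; have [s ws <-] := total_acquisition_reach w.
have [z w'z [x [B [zs B0 zx cB]]]] : exists2 z, reach w' z & dominated s z.
  elim: ws => [|{}s a b _ [z w'z sz] sab].
    exists w'; first exact: reach_refl.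
    exists v, finset.set0; split=> // [y _|y|]; [exact: w'w|by rewrite inE|].
    rewrite cards0 add0n; apply: leq_trans (deg2 v); apply: subset_leq_card.
    by apply/fintype.subsetP => y; rewrite !inE => /andP[].
  have [z' zz' sz'] := dominated_move sz sab.
  by exists z' => //; exact: reach_trans zz'.
apply: leq_trans (total_acquisition_le w'z) _.
have /subset_leq_card : [set y | 0 < z y] \subset B :|: [set y | 0 < s y].
  apply/fintype.subsetP => y; rewrite !inE; have [//|yB] := boolP (y \in B).
  by have [->|yx] := eqVneq y x; [move/leq_trans; exact | rewrite zs].
move=> /leq_trans -> //; rewrite (leq_trans (leq_card_setU _ _)) //.
by rewrite -add2n leq_add2r; apply: leq_trans cB; rewrite leq_addr.
Qed.

Lemma total_acquisition_lipschitz v w w' : {in predC1 v, w' =1 w} ->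
  total_acquisition w <= total_acquisition w' + 3.
Proof.
move=> w'w; pose w0 : weighting G := [ffun y => if y == v then 0 else w y].
have w0w : {in predC1 v, w0 =1 w} by move=> y /negbTE yv; rewrite ffunE yv.
have w0v : w0 v = 0 by rewrite ffunE eqxx.
apply: leq_trans (total_acquisition_add_vertex w0w w0v) _.
rewrite addn3 ltnS; apply: (@total_acquisition_decrease v); last by rewrite w0v.
by move=> y yv; rewrite w0w ?w'w.
Qed.

End Reachability.

(** * Concatenation of protocols *)

Lemma reach_embed (H G : sgraph) (phi : H -> G) (w : weighting G) a :
  injective phi -> (forall u v, edge u v -> edge (phi u) (phi v)) ->
  reach [ffun x => w (phi x)] a ->
  exists s, [/\ reach w s, forall x, s (phi x) = a x &
                forall y, y \notin codom phi -> s y = w y].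
Proof.
move=> inj hom; elim=> [|{}a u v _ [s [ws sa sw]] auv].
  by exists w; split=> // [|x]; [exact: reach_refl | rewrite ffunE].
exists (make_move s (phi u) (phi v)); split.
- apply: reach_move => //; move: auv; rewrite /legal_move !sa.
  by case/and3P => /hom -> -> ->.
- by move=> x; rewrite !ffunE !(inj_eq inj) !sa.
- move=> y yphi; rewrite ffunE (sw y) //; have [yu|_] := eqVneq y (phi u).
    by rewrite yu codom_f in yphi.
  have [yv|_] := eqVneq y (phi v); last by [].
  by rewrite yv codom_f in yphi.
Qed.

(** An optimal run inside the image of [f] leaves the weights on the image of [g] untouched, so an
    optimal run there can follow it. What survives lies in the images of the two final supports. *)
Lemma total_acquisition_split (G1 G2 G : sgraph) (f : G1 -> G) (g : G2 -> G)
    (w : weighting G) :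
  injective f -> (forall u v, edge u v -> edge (f u) (f v)) ->
  injective g -> (forall u v, edge u v -> edge (g u) (g v)) ->
  (forall x y, f x != g y) -> (forall z, (z \in codom f) || (z \in codom g)) ->
  total_acquisition w <=
    total_acquisition ([ffun x => w (f x)] : weighting G1) +
    total_acquisition ([ffun x => w (g x)] : weighting G2).
Proof.
move=> finj fhom ginj ghom fg cover.
have [a wa <-] := total_acquisition_reach ([ffun x => w (f x)] : weighting G1).
have [b wb <-] := total_acquisition_reach ([ffun x => w (g x)] : weighting G2).
have [s [ws sa sw]] := reach_embed finj fhom wa.
have wsg : [ffun x => w (g x)] = [ffun x => s (g x)] :> weighting G2.
  apply/ffunP => x; rewrite !ffunE sw //.
  by apply/codomP => -[y /eqP]; rewrite eq_sym (negbTE (fg _ _)).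
rewrite wsg in wb; have [t [st tb ts]] := reach_embed ginj ghom wb.
apply: leq_trans (total_acquisition_le (reach_trans ws st)) _.
apply: (@leq_trans #|f @: [set x | 0 < a x] :|: g @: [set x | 0 < b x]|).
  apply/subset_leq_card/fintype.subsetP => y; rewrite !inE => y0.
  have := cover y; have [/codomP[x yx] _|yg] := boolP (y \in codom g).
    by apply/orP; right; rewrite yx imset_f // inE -tb -yx.
  rewrite orbF => /codomP[x yx]; apply/orP; left.
  by rewrite yx imset_f // inE -sa -yx -(ts _ yg).
by rewrite (leq_trans (leq_card_setU _ _)) ?leq_add ?leq_imset_card.
Qed.

Lemma path_graph_deg2 n (x : path_graph n) : #|[set y | edge x y]| <= 2.
Proof.
(* At an end of the path one of these candidates is not a neighbour ([x.-1] is [0] itself when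
   [x = 0]), which is harmless for an upper bound. *)
rewrite cardE -(size_map val); apply: (@uniq_leq_size _ _ [:: x.+1; x.-1]).
  by rewrite (map_inj_uniq val_inj) enum_uniq.
move=> _ /mapP[y + ->]; rewrite mem_enum !inE /edge /= /path_edge.
by case/orP=> /eqP e; rewrite -e eqxx ?orbT.
Qed.

Lemma total_acquisition_path_cat m n (w : weighting (path_graph (m + n))) :
  total_acquisition w <=
    total_acquisition ([ffun x => w (lshift n x)] : weighting (path_graph m)) +
    total_acquisition ([ffun x => w (rshift m x)] : weighting (path_graph n)).
Proof.
apply: (@total_acquisition_split (path_graph m) (path_graph n)).
- exact: lshift_inj.
- by [].
- exact: rshift_inj.
- by move=> u v; rewrite /edge /= /path_edge /= -!addnS !eqn_add2l.
- by move=> x y; rewrite eq_lrshift.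
- move=> z; case: (split_ordP z) => x ->; first by rewrite (codom_f (lshift n)).
  by rewrite (codom_f (@rshift m n)) orbT.
Qed.

(** * Uniform placements of chips *)

Definition ffun_cons (T : Type) m (v : T) (c : {ffun 'I_m -> T}) :
    {ffun 'I_m.+1 -> T} :=
  [ffun i => if unlift ord0 i is Some j then c j else v].

Lemma big_ffun_recl (V : Type) (idx : V) (op : Monoid.com_law idx)
    (T : finType) m (F : {ffun 'I_m.+1 -> T} -> V) :
  \big[op/idx]_c F c =
  \big[op/idx]_(v : T) \big[op/idx]_(c : {ffun 'I_m -> T}) F (ffun_cons v c).
Proof.
rewrite pair_big (reindex (fun p : T * {ffun 'I_m -> T} => ffun_cons p.1 p.2)) //.
exists (fun c : {ffun 'I_m.+1 -> T} => (c ord0, [ffun i => c (lift ord0 i)])) => [[v c] _|c _] /=.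
  by rewrite ffunE unlift_none; congr (_, _); apply/ffunP=> i;
    rewrite !ffunE liftK.
by apply/ffunP => i; rewrite ffunE; case: unliftP => [j|] ->; rewrite ?ffunE.
Qed.

Definition add_chip (G : sgraph) (v : G) (w : weighting G) : weighting G :=
  [ffun x => (x == v) + w x].

Lemma chip_weighting_cons n m (v : 'I_n) (c : {ffun 'I_m -> 'I_n}) :
  chip_weighting (ffun_cons v c) = add_chip (G := path_graph n) v (chip_weighting c).
Proof.
apply/ffunP => x; rewrite !ffunE -!sum1dep_card !(big_mkcond (fun i => _ == _)).
rewrite big_ord_recl /= ffunE unlift_none eq_sym; congr addn.
by apply: eq_bigr => i _; rewrite ffunE liftK.
Qed.

Lemma chip_weighting_total n m (c : 'I_m -> 'I_n) :
  \sum_i chip_weighting c i = m.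
Proof.
under eq_bigr do rewrite ffunE -sum1dep_card big_mkcond.
rewrite exchange_big /= -[RHS]card_ord -sum1_card; apply: eq_bigr => i _.
by rewrite -big_mkcond /= (big_pred1 (c i)) // => j; rewrite eq_sym.
Qed.

Lemma add_chip_eq n (v : 'I_n) (u w : weighting (path_graph n)) : 0 < w v ->
  (add_chip (G := path_graph n) v u == w) = (u == [ffun x => w x - (x == v)]).
Proof.
move=> wv; apply/eqP/eqP => [<-|->]; apply/ffunP => x; rewrite !ffunE.
  by rewrite addKn.
by have [->|] := eqVneq x v; rewrite ?subn0 // subnKC.
Qed.

(** This is the multinomial coefficient, with its denominator moved to the left so that the identity
    stays in [nat]. The induction conditions on the position of the first chip. *)
Lemma card_chip_weighting n m (w : weighting (path_graph n)) :
  (\sum_(c : {ffun 'I_m -> 'I_n}) (chip_weighting c == w)) * \prod_i (w i)`! =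
  m`! * (\sum_i w i == m).
Proof.
elim: m w => [|m IH] w.
  have c0 (c : {ffun 'I_0 -> 'I_n}) : chip_weighting c = [ffun=> 0].
    by apply/ffunP => x; rewrite !ffunE; apply/eqP; rewrite cards_eq0;
      apply/eqP/setP => -[].
  under [X in X * _]eq_bigr do rewrite c0.
  rewrite sum_nat_const card_ffun !card_ord expn0 !mul1n.
  have [<-|w0] := eqVneq.
    rewrite !big1 // => i _; by rewrite ffunE.
  rewrite mul0n sum_nat_eq0; apply/esym/eqP; rewrite eqb0.
  apply: contra w0 => /forallP w0; apply/eqP/ffunP => i; rewrite ffunE.
  exact/esym/eqP/w0.
rewrite big_ffun_recl big_distrl /=.
(* A first chip at [v] accounts for [w v * m!]; the factors [w v] add up to [m.+1]. *)
transitivity (\sum_v w v * (m`! * (\sum_i w i == m.+1))); last first.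
  rewrite -big_distrl /= factS -mulnA;
    have [->//|_] := eqVneq (\sum_i w i) m.+1.
  by rewrite !muln0.
apply: eq_bigr => v _; have [wv|wv] := posnP (w v).
  rewrite wv mul0n big1 ?mul0n // => c _; apply/eqP; rewrite eqb0.
  rewrite chip_weighting_cons; apply: contra_eqN wv => /eqP <-.
  by rewrite ffunE eqxx.
(* The first chip is taken away; the truncated subtraction is exact because [0 < w v]. *)
set w' : weighting (path_graph n) := [ffun x => w x - (x == v)].
under eq_bigr do rewrite chip_weighting_cons add_chip_eq // -/w'.
have -> : \prod_i (w i)`! = w v * \prod_i (w' i)`!.
  rewrite (bigD1 v) //= [in RHS](bigD1 v) //= mulnA; congr muln.
    by rewrite ffunE eqxx subn1 -[in LHS](prednK wv) factS prednK.
  by apply: eq_bigr => i /negbTE iv; rewrite ffunE iv subn0.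
rewrite mulnCA IH; congr (_ * (_ * nat_of_bool _)).
have -> : \sum_i w i = (\sum_i w' i).+1; last by rewrite eqSS.
rewrite (bigD1 v) //= [in RHS](bigD1 v) //= ffunE eqxx subn1 -addSn prednK //.
by congr addn; apply: eq_bigr => i /negbTE iv; rewrite ffunE iv subn0.
Qed.

(** * Averages over placements and their dependence on the number of chips *)

Local Open Scope classical_set_scope.
Local Open Scope ring_scope.

(** A finite average, tied to no probability space: both models are expressed through it and
    compared as numbers. *)
Definition chip_mean (R : realType) n (F : weighting (path_graph n) -> R) m : R :=
  (\sum_(c : {ffun 'I_m -> 'I_n}) F (chip_weighting c)) / n%:R ^+ m.

Section ChipMean.
Variables (R : realType) (n : nat) (F : weighting (path_graph n.+1) -> R) (C : R).

Let cst_mean (a : R) m : a = (\sum_(c : {ffun 'I_m -> 'I_n.+1}) a) / n.+1%:R ^+ m.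
Proof.
by rewrite sumr_const card_ffun !card_ord -(mulr_natr a) natrX mulfK // expf_neq0 // pnatr_eq0.
Qed.

Lemma ler_chip_mean (a : R) m : (forall w, F w <= a) -> chip_mean F m <= a.
Proof.
move=> Fa; rewrite (cst_mean a m) ler_wpM2r ?invr_ge0 ?exprn_ge0 //.
by apply: ler_sum => c _; exact: Fa.
Qed.

Lemma chip_mean_ge0 m : (forall w, 0 <= F w) -> 0 <= chip_mean F m.
Proof. by move=> F0; rewrite divr_ge0 ?exprn_ge0 ?sumr_ge0. Qed.

Hypothesis FC : forall v w, `|F (add_chip (G := path_graph n.+1) v w) - F w| <= C.

Lemma chip_meanS m : `|chip_mean F m.+1 - chip_mean F m| <= C.
Proof.
(* A coupling: the mean over [m] chips is also a mean over [m.+1] chips whose first chip is ignored,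
   so the two means differ term by term by the effect of one chip. *)
have -> : chip_mean F m = (\sum_(v < n.+1) \sum_(c : {ffun 'I_m -> 'I_n.+1})
    F (chip_weighting c)) / n.+1%:R ^+ m.+1.
  rewrite sumr_const card_ord -(mulr_natl (\sum_c _)) exprS invfM mulrACA divff ?mul1r //.
rewrite /chip_mean -mulrBl big_ffun_recl -sumrB normrM.
rewrite [X in _ * X]ger0_norm ?invr_ge0 ?exprn_ge0 // (cst_mean C m.+1).
rewrite ler_wpM2r ?invr_ge0 ?exprn_ge0 // big_ffun_recl.
apply: le_trans (ler_norm_sum _ _ _) _; apply: ler_sum => v _ /=.
rewrite -sumrB; apply: le_trans (ler_norm_sum _ _ _) _; apply: ler_sum => c _.
by rewrite chip_weighting_cons.
Qed.

Lemma chip_mean_lipschitz m k :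
  `|chip_mean F m - chip_mean F k| <= C * `|m%:R - k%:R|.
Proof.
wlog km : m k / (k <= m)%N.
  by move=> H; have [/H//|/ltnW/H] := leqP k m; rewrite distrC (distrC k%:R).
rewrite -natrB // normr_nat -(subnKC km); move: (m - k)%N => {m km} d.
rewrite addKn; elim: d => [|d IH]; first by rewrite addn0 subrr normr0 mulr0.
rewrite addnS -natr1 mulrDr mulr1 [leRHS]addrC.
apply: le_trans (ler_distD (chip_mean F (k + d)%N) _ _) _.
by rewrite lerD ?chip_meanS.
Qed.

End ChipMean.

Local Open Scope ereal_scope.

(** * The Poisson distribution *)

Section PoissonMoments.
Variables (R : realType) (r : R).
Hypothesis r_gt0 : (0 < r)%R.
Local Notation p := (poisson_pmf r).
Implicit Types h : nat -> R.

Let p_ge0 m : (0 <= p m)%R := poisson_pmf_ge0 r m.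

Let ph_ge0 h : (forall m, 0 <= h m)%R -> forall m, 0 <= (p m * h m)%:E.
Proof. by move=> h0 m; rewrite lee_fin mulr_ge0. Qed.

Lemma poisson_pmf_sum1 : \sum_(m <oo) (p m)%:E = 1.
Proof.
have := @probability_setT _ _ _ (poisson_prob r 0).
rewrite /= /poisson_prob r_gt0 => <-.
by rewrite nneseries_esumT // => m _; rewrite lee_fin.
Qed.

(** The Stein-Chen identity [E[N h(N)] = r E[h(N + 1)]]; the first two moments follow from [h = 1]
    and [h(m) = m]. *)
Lemma poisson_pmf_shift h : (forall m, 0 <= h m)%R ->
  \sum_(m <oo) (p m * (m%:R * h m))%:E = r%:E * \sum_(m <oo) (p m * h m.+1)%:E.
Proof.
move=> h0; rewrite -nneseriesZl; last by move=> m _;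
  exact: ph_ge0 (fun m => h0 m.+1) m.
have h0' m : (0 <= m%:R * h m :> R)%R by rewrite mulr_ge0.
rewrite nneseries_recl //; last by move=> m _; exact: ph_ge0 h0' m.
rewrite mul0r mulr0 add0e -nneseries_addn; last by move=> m;
  exact: ph_ge0 h0' m.
apply: eq_eseriesr => m _; rewrite addn1 -EFinM; congr EFin.
rewrite /poisson_pmf r_gt0 factS natrM exprS invfM.
have m0 : (m.+1%:R != 0 :> R)%R by rewrite pnatr_eq0.
have f0 : (m`!%:R != 0 :> R)%R by rewrite pnatr_eq0 -lt0n fact_gt0.
by field; rewrite f0 addrC natr1.
Qed.

Lemma poisson_pmf_sumD h h' :
  (forall m, 0 <= h m)%R -> (forall m, 0 <= h' m)%R ->
  \sum_(m <oo) (p m * (h m + h' m))%:E =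
  \sum_(m <oo) (p m * h m)%:E + \sum_(m <oo) (p m * h' m)%:E.
Proof.
move=> h0 h'0; rewrite -nneseriesD; try by move=> m _ _; exact: ph_ge0.
by apply: eq_eseriesr => m _; rewrite mulrDr EFinD.
Qed.

Lemma poisson_pmf_sumZ (a : R) h : (forall m, 0 <= h m)%R ->
  \sum_(m <oo) (p m * (a * h m))%:E = a%:E * \sum_(m <oo) (p m * h m)%:E.
Proof.
move=> h0; rewrite -nneseriesZl; last by move=> m _; exact: ph_ge0.
by apply: eq_eseriesr => m _; rewrite -EFinM mulrCA.
Qed.

Lemma poisson_pmf_sum_cst (a : R) : \sum_(m <oo) (p m * a)%:E = a%:E.
Proof.
have := @poisson_pmf_sumZ a (fun=> 1%R) (fun=> ler01).
rewrite (eq_eseriesr (g := fun m => (p m * a)%:E)); last by move=> m _;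
  rewrite mulr1.
move=> ->; rewrite (eq_eseriesr (g := fun m => (p m)%:E)); last by move=> m _;
  rewrite mulr1.
by rewrite poisson_pmf_sum1 mule1.
Qed.

Lemma poisson_pmf_mean : \sum_(m <oo) (p m * m%:R)%:E = r%:E.
Proof.
have := @poisson_pmf_shift (fun=> 1%R) (fun=> ler01).
rewrite poisson_pmf_sum_cst mule1 => <-.
by apply: eq_eseriesr => m _; rewrite mulr1.
Qed.

Lemma poisson_pmf_moment2 : \sum_(m <oo) (p m * m%:R ^+ 2)%:E = (r ^+ 2 + r)%:E.
Proof.
have := @poisson_pmf_shift (fun m => m%:R%R) (fun=> ler0n _ _).
under eq_eseriesr do rewrite -expr2.
under [in RHS]eq_eseriesr do rewrite -natr1.
rewrite poisson_pmf_sumD // poisson_pmf_mean poisson_pmf_sum_cst => ->.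
by rewrite -EFinD -EFinM mulrDr mulr1 expr2.
Qed.

Lemma poisson_pmf_variance : \sum_(m <oo) (p m * (m%:R - r) ^+ 2)%:E = r%:E.
Proof.
have r2 : (0 <= 2 * r)%R by rewrite mulr_ge0 // ltW.
(* Additivity is available for nonnegative terms, so the cross term is moved to the other side:
   [(m - r)^2 + 2 r m = m^2 + r^2]. *)
rewrite -[LHS](@addeK _ (2 * r * r)%:E) // EFinM.
rewrite -[X in _ + _ * X]poisson_pmf_mean -poisson_pmf_sumZ // -poisson_pmf_sumD.
- transitivity (\sum_(m <oo) (p m * (m%:R ^+ 2 + r ^+ 2))%:E - (2 * r * r)%:E).
    by congr (_ - _); apply: eq_eseriesr => m _; congr (_ * _)%:E; ring.
  rewrite poisson_pmf_sumD ?poisson_pmf_moment2 ?poisson_pmf_sum_cst.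
  + by rewrite -!EFinD; congr EFin; ring.
  + by move=> m; rewrite sqr_ge0.
  + by move=> m; rewrite sqr_ge0.
- by move=> m; rewrite sqr_ge0.
- by move=> m; rewrite mulr_ge0.
Qed.

Lemma poisson_pmf_sum_sqr (a b : R) : (0 <= a)%R -> (0 <= b)%R ->
  \sum_(m <oo) (p m * (a + b * (m%:R - r) ^+ 2))%:E = (a + b * r)%:E.
Proof.
move=> a0 b0; rewrite poisson_pmf_sumD //; last by move=> m;
  rewrite mulr_ge0 ?sqr_ge0.
rewrite poisson_pmf_sum_cst poisson_pmf_sumZ; last by move=> m; rewrite sqr_ge0.
by rewrite poisson_pmf_variance -EFinM.
Qed.

End PoissonMoments.

Section PoissonConcentration.
Variables (R : realType) (g : nat -> R) (C : R).
Hypothesis g_ge0 : forall m, (0 <= g m)%R.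
Hypothesis C_ge0 : (0 <= C)%R.
Hypothesis gC : forall m k, (`|g m - g k| <= C * `|m%:R - k%:R|)%R.

(** The first absolute moment is bounded through the variance by a pointwise quadratic majorant [e]
    of [|g m - g n.+1|], whose Poisson mean is exactly [C * s]. Two one-sided bounds avoid
    subtracting an extended real not yet known to be finite. *)
Lemma poisson_pmf_lipschitz n :
  (g n.+1)%:E <= \sum_(m <oo) (poisson_pmf n.+1%:R m * g m)%:E +
                 (C * Num.sqrt n.+1%:R)%:E /\
  \sum_(m <oo) (poisson_pmf n.+1%:R m * g m)%:E <=
    (g n.+1 + C * Num.sqrt n.+1%:R)%:E.
Proof.
set r : R := n.+1%:R; set s := Num.sqrt r.
have r0 : (0 < r)%R by rewrite ltr0n.
have s0 : (0 < s)%R by rewrite sqrtr_gt0.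
have ss : (s * s = r)%R by rewrite -expr2 sqr_sqrtr // ltW.
have a0 : (0 <= C * s / 2)%R by rewrite divr_ge0 ?mulr_ge0 // ltW.
have b0 : (0 <= C / (2 * s))%R by rewrite divr_ge0 ?mulr_ge0 // ltW.
pose e m : R := (C * s / 2 + C / (2 * s) * (m%:R - r) ^+ 2)%R.
have e0 m : (0 <= e m)%R by rewrite addr_ge0 // mulr_ge0 // sqr_ge0.
have p0 m := poisson_pmf_ge0 r m.
(* AM-GM with the optimal weight: |m - r| <= (s + (m - r)^2 / s) / 2. *)
have ge m : (`|g m - g n.+1| <= e m)%R.
  apply: le_trans (gC _ _) _.
  rewrite -/r (_ : e m = C * ((s + (m%:R - r) ^+ 2 / s) / 2))%R; last first.
    by rewrite /e; field; rewrite gt_eqF.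
  rewrite ler_wpM2l // -[X in (X / s)%R]real_normK ?num_real //.
  rewrite ler_pdivlMr // -(ler_pM2r s0).
  rewrite (_ : (s + `|m%:R - r| ^+ 2 / s) * s = s ^+ 2 + `|m%:R - r| ^+ 2)%R;
    last first.
    by field; rewrite gt_eqF.
  by have := sqr_ge0 (`|m%:R - r| - s)%R; lra.
(* The variance is [r = s * s], so the quadratic part of [e] contributes a second [C * s / 2]. *)
have sumE : (C * s / 2 + C / (2 * s) * r = C * s)%R.
  by rewrite -ss; field; rewrite gt_eqF.
split.
  rewrite -sumE -(poisson_pmf_sum_sqr r0 a0 b0) -(poisson_pmf_sum_cst r0 (g n.+1)).
  rewrite -poisson_pmf_sumD //; apply: lee_nneseries => m *;
    first by rewrite lee_fin mulr_ge0.
  rewrite lee_fin ler_wpM2l //; have := ge m; rewrite ler_norml -/(e m); lra.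
rewrite -sumE addrA -(poisson_pmf_sum_sqr r0) ?addr_ge0 //.
apply: lee_nneseries => m *; first by rewrite lee_fin mulr_ge0.
rewrite lee_fin ler_wpM2l // -addrA; have := ge m; rewrite ler_norml /e; lra.
Qed.

End PoissonConcentration.

(** * Poissonization *)

(** Finitely many coordinates with countably many values give countably many functions, so the
    preimage of any [B] is a countable union of preimages of points. No sigma-algebra on the
    functions is involved. *)
Lemma measurable_ffun d (T : measurableType d) (I : finType) (V : countType)
    (Z : I -> T -> V) (B : set {ffun I -> V}) :
  (forall i v, measurable (Z i @^-1` [set v])) ->
  measurable [set t | B [ffun i => Z i t]].
Proof.
move=> mZ.
have mpoint (w : {ffun I -> V}) : measurable [set t | [ffun i => Z i t] = w].
  rewrite (_ : mkset _ = \bigcap_(i in [set: I]) (Z i @^-1` [set w i])).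
    by apply: fin_bigcap_measurable => // i _; exact: mZ.
  apply/seteqP; split=> [t /= <- i _ /=|t /= Zw]; first by rewrite ffunE.
  by apply/ffunP => i; rewrite ffunE; exact: Zw.
rewrite (_ : mkset _ =
    \bigcup_(w in setT) [set t | B w /\ [ffun i => Z i t] = w]); last first.
  apply/seteqP; split=> [t /= Bt|t [w _ [Bw tw]]]; last by rewrite /= tw.
  by exists [ffun i => Z i t].
apply: countable_bigcupT_measurable => // w; have [Bw|Bw] := pselect (B w).
  by rewrite (_ : mkset _ = [set t | [ffun i => Z i t] = w]) //; apply/seteqP;
    split=> // t [].
by rewrite (_ : mkset _ = set0) // -subset0 => t [].
Qed.

Lemma mutually_independent_law d (T : measurableType d) (R : realType)
    (P : probability T R) d' (T' : measurableType d') (I : finType)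
    (X : I -> {RV P >-> T'}) (x : I -> T') :
  mutually_independent X -> (forall y : T', measurable [set y]) ->
  P [set t | forall i, X i t = x i] = \prod_i P (X i @^-1` [set x i]).
Proof.
move=> indep m1; have := indep [set: I]%SET (fun i => [set x i]).
move=> /(_ (fun i _ => m1 _)); under [RHS]eq_bigl do rewrite inE.
move=> <-; congr (P _); apply/seteqP; split=> [t /= Xx i _ /=|t Xx i] //.
by apply: (Xx i); rewrite /= inE.
Qed.

Lemma mutually_independent_comp d (T : measurableType d) (R : realType)
    (P : probability T R) d' (T' : measurableType d') (I J : finType)
    (X : I -> {RV P >-> T'}) (f : J -> I) :
  injective f -> mutually_independent X -> mutually_independent (X \o f).
Proof.
move=> finj indep K B mB;
  (* The events are transported along [f]; the default [setT] is never consulted, as only indices in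
     [f @: K] occur. *)
  pose B' i := if [pick j | f j == i] is Some j then B j else setT.
have B'f j : B' (f j) = B j.
  rewrite /B'; case: pickP => [k /eqP/finj->//|/(_ j)]; by rewrite eqxx.
have := indep (f @: K)%SET B'; rewrite big_imset /=; last by move=> ? ? _ _;
  exact: finj.
under eq_bigr do rewrite B'f.
move=> <-; first last.
  by move=> _ /imsetP[j jK ->]; rewrite B'f; exact: mB.
congr (P _); apply/seteqP; split=> [t /= H _ /imsetP[j jK ->]|t H j /= jK].
  by rewrite B'f; exact: H.
by have := H (f j); rewrite /= B'f; apply; exact: imset_f.
Qed.

Section Poissonization.
Context d (T : measurableType d) (R : realType) (P : probability T R) (n : nat).
Variable (Y : 'I_n.+1 -> {RV P >-> nat}).
Hypothesis Y_indep : mutually_independent Y.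
Hypothesis Y_poisson : forall i, poisson_distributed 1%R (Y i).
Implicit Type w : weighting (path_graph n.+1).

Let W t : weighting (path_graph n.+1) := [ffun v => Y v t].

Let mY i k : measurable (Y i @^-1` [set k]).
Proof. by rewrite -[X in measurable X]setTI; exact: measurable_funP. Qed.

Lemma measurable_poisson_weighting (B : set (weighting (path_graph n.+1))) :
  measurable [set t | B (W t)].
Proof. exact: measurable_ffun. Qed.

Lemma poisson_weighting_law w :
  P [set t | W t = w] = (expR (- n.+1%:R) / (\prod_i (w i)`!)%:R)%:E.
Proof.
rewrite (_ : mkset _ = [set t | forall i, Y i t = w i]); last first.
  apply/seteqP; split=> t /= => [<- i|Yw]; first by rewrite ffunE.
  by apply/ffunP => i; rewrite ffunE.
rewrite mutually_independent_law //.
rewrite (eq_bigr (fun i => (poisson_pmf 1%R (w i))%:E)); last by move=> i _;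
  exact: Y_poisson.
rewrite prodEFin; congr EFin; rewrite /poisson_pmf ltr01.
under eq_bigr do rewrite expr1n mul1r.
rewrite big_split /= prodr_const card_ord -expRM_natl mulrN1 mulrC;
  congr (_ * _)%R.
by rewrite prodfV natr_prod.
Qed.

(** A weighting [w] of total [m] has probability [e^-N / prod (w i)!] with [N = n.+1]. This is the
    Poisson weight [e^-N N^m / m!] times the multinomial probability [(m! / prod (w i)!) / N^m]. *)
Lemma poissonization (F : weighting (path_graph n.+1) -> R) :
  (forall w, 0 <= F w)%R ->
  \int[P]_t (F (W t))%:E =
  \sum_(m <oo) (poisson_pmf n.+1%:R m * chip_mean F m)%:E.
Proof.
move=> F0.
pose D m := [set t | (\sum_i W t i)%N = m].
have mD m : measurable (D m).
  exact: (measurable_poisson_weighting (fun w => (\sum_i w i)%N = m)).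
have mFW : measurable_fun setT ((fun t => (F (W t))%:E) : T -> \bar R).
  apply/measurable_EFinP => _ B mB; rewrite setTI.
  exact: (measurable_poisson_weighting (fun w => B (F w))).
have DT : \bigcup_m D m = setT.
  by rewrite -subTset => t _; exists (\sum_i W t i)%N.
rewrite -DT ge0_integral_bigcup //; first last.
- by move=> i j _ _ [t [<- <-]].
- by move=> t _; rewrite lee_fin.
- by rewrite DT.
apply: eq_eseriesr => m _.
pose A (c : {ffun 'I_m -> 'I_n.+1}) := [set t | W t = chip_weighting c].
have mA c : measurable (A c).
  exact: (measurable_poisson_weighting (fun w => w = chip_weighting c)).
(* [K w] shares [F w] equally among the [m! / prod (w i)!] placements that produce [w], turning the
   integral over [D m] into a sum over placements. *)
pose K w : R := (F w * (\prod_i (w i)`!)%:R / m`!%:R)%R.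
have K0 w : (0 <= K w)%R by rewrite divr_ge0 ?mulr_ge0.
have mf0 : (m`!%:R != 0 :> R)%R by rewrite pnatr_eq0 -lt0n fact_gt0.
transitivity (\int[P]_(t in D m) \sum_(c : {ffun 'I_m -> 'I_n.+1})
    ((K (chip_weighting c))%:E * (\1_(A c) t)%:E)).
  apply: eq_integral => t; rewrite inE => Dt.
  transitivity (\sum_(c : {ffun 'I_m -> 'I_n.+1})
      (K (W t) * (chip_weighting c == W t)%:R)%:E).
    rewrite sumEFin; congr EFin; rewrite -mulr_sumr -natr_sum /K mulrAC.
    rewrite -(mulrA (F _)) -natrM mulnC card_chip_weighting Dt eqxx muln1.
    by rewrite mulfK.
  apply: eq_bigr => c _; rewrite -EFinM; congr EFin; rewrite indicE.
  have [cW|cW] := eqVneq (chip_weighting c) (W t).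
    by rewrite cW mem_set // /A /= cW.
  by rewrite memNset ?mulr0 // => /esym/eqP; rewrite (negbTE cW).
rewrite ge0_integral_sum //; first last.
- by move=> c t _; rewrite -EFinM lee_fin mulr_ge0.
- move=> c; apply: measurable_funeM; apply/measurable_EFinP.
  exact: measurable_funTS.
transitivity (\sum_(c : {ffun 'I_m -> 'I_n.+1})
    (F (chip_weighting c) * (expR (- n.+1%:R) / m`!%:R))%:E).
  apply: eq_bigr => c _; rewrite ge0_integralZl_EFin //; first last.
  - by apply/measurable_EFinP; exact: measurable_funTS.
  rewrite integral_indic // (_ : A c `&` D m = A c); last first.
    by apply: setIidl => t At; rewrite /D /= At chip_weighting_total.
  rewrite [X in _ * X](poisson_weighting_law (chip_weighting c)) -EFinM;
    congr EFin; rewrite /K.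
  have p0 : ((\prod_i (chip_weighting c i)`!)%:R != 0 :> R)%R.
    by rewrite pnatr_eq0 -lt0n prodn_gt0 // => i; exact: fact_gt0.
  by field; rewrite p0 mf0.
rewrite sumEFin -mulr_suml /chip_mean /poisson_pmf ltr0n /=; congr EFin.
have nm0 : (n.+1%:R ^+ m != 0 :> R)%R by rewrite expf_neq0 // pnatr_eq0.
move: (_ ^+ m)%R nm0 (expR _) (\sum_c _)%R => N N0 e S.
by field; rewrite N0 mf0.
Qed.

End Poissonization.

Lemma uniform_chips_mean d (T : measurableType d) (R : realType)
    (P : probability T R) n m (X : 'I_m -> {RV P >-> 'I_n.+1})
    (F : weighting (path_graph n.+1) -> R) :
  mutually_independent X -> (forall i, uniformly_distributed (X i)) ->
  (forall w, 0 <= F w)%R ->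
  \int[P]_t (F (chip_weighting (fun i => X i t)))%:E = (chip_mean F m)%:E.
Proof.
move=> indep unif F0.
pose A (c : {ffun 'I_m -> 'I_n.+1}) := [set t | forall i, X i t = c i].
have mA c : measurable (A c).
  rewrite (_ : A c = [set t | [ffun i => X i t] = c]); last first.
    apply/seteqP; split=> t /= => [Xc|<- i]; last by rewrite ffunE.
    by apply/ffunP => i; rewrite ffunE.
  apply: (@measurable_ffun _ _ _ _ (fun i => X i : T -> 'I_n.+1) (fun f => f = c)) => i v.
  by rewrite -[X in measurable X]setTI; exact: measurable_funP.
transitivity (\int[P]_t \sum_(c : {ffun 'I_m -> 'I_n.+1})
    ((F (chip_weighting c))%:E * (\1_(A c) t)%:E)).
  apply: eq_integral => t _; rewrite (bigD1 [ffun i => X i t]) //= big1 ?adde0.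
    rewrite indicE mem_set ?mule1 => [|i]; last by rewrite ffunE.
    by congr (F _)%:E; apply/ffunP => v; rewrite !ffunE; apply: eq_card => i;
      rewrite !inE ffunE.
  move=> c cX; rewrite indicE memNset ?mule0 // => Ac.
  by case/eqP: cX; apply/ffunP => i; rewrite ffunE Ac.
rewrite ge0_integral_sum //; first last.
- by move=> c t _; rewrite -EFinM lee_fin mulr_ge0.
- by move=> c; apply: measurable_funeM; apply/measurable_EFinP.
rewrite /chip_mean mulr_suml -sumEFin; apply: eq_bigr => c _.
rewrite ge0_integralZl_EFin //; last by apply/measurable_EFinP.
rewrite integral_indic // setIT [X in _ * X](mutually_independent_law c indep) //.
rewrite (eq_bigr (fun=> (n.+1%:R^-1)%:E)); last by move=> i _; exact: unif.
by rewrite prodEFin prodr_const card_ord -EFinM exprVn.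
Qed.

(** * Limits *)

(** The limit is the infimum of the ratios. The linear bound on [u] controls the remainder when a
    long stretch is cut into blocks of a nearly optimal length [p.+1]. *)
Lemma fekete (R : realType) (u : nat -> R) :
  (forall n, 0 <= u n <= n%:R)%R ->
  (forall m n, u (m + n)%N <= u m + u n)%R ->
  exists l : R, (u n.+1 / n.+1%:R)%R @[n --> \oo] --> l.
Proof.
move=> u_bnd u_sub; pose S := [set (u n.+1 / n.+1%:R)%R | n in [set: nat]].
have u0 n : (0 <= u n)%R by case/andP: (u_bnd n).
have Slb : lbound S 0%R by move=> _ [n _ <-]; rewrite divr_ge0.
have Sinf : has_inf S by split; [exists (u 1%N / 1)%R; exists 0%N | exists 0%R].
exists (inf S); apply/cvgrPdist_lt => e e0.
have e20 : (0 < e / 2)%R by rewrite divr_gt0.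
have [_ [p _ <-] up] := inf_adherent e20 Sinf.
have u_div q r : (u (q * p.+1 + r)%N <= q%:R * u p.+1 + r%:R)%R.
  elim: q => [|q IH]; first by rewrite mul0r add0r; case/andP: (u_bnd r).
  rewrite mulSn -addnA; apply: le_trans (u_sub _ _) _.
  by rewrite -natr1 mulrDl mul1r (addrC (_ * _)%R) -addrA lerD2l.
have ep : (0 < e / 2 / p.+1%:R)%R by rewrite !divr_gt0.
near=> n.
have ln : (inf S <= u n.+1 / n.+1%:R)%R by apply: ge_inf; [exists 0%R|exists n].
rewrite distrC ger0_norm ?subr_ge0 // ltrBlDl.
(* The remainder modulo [p.+1] costs at most [p.+1], hence less than [e / 2] after division. *)
have np : (p.+1%:R / n.+1%:R < e / 2 :> R)%R.
  rewrite mulrC -ltr_pdivlMr //; near: n;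
    exact: (near_infty_natSinv_lt (PosNum ep)).
apply: (@le_lt_trans _ _ (u p.+1 / p.+1%:R + p.+1%:R / n.+1%:R)%R); last first.
  by rewrite [e]splitr addrA ltrD.
rewrite ler_pdivrMr // mulrDl divfK ?pnatr_eq0 //.
rewrite {1}(divn_eq n.+1 p.+1); apply: le_trans (u_div _ _) _.
rewrite lerD // ?ler_nat ?(ltnW (ltn_pmod _ _)) //.
rewrite mulrC -mulrA ler_wpM2l // mulrC ler_pdivlMr // -natrM ler_nat.
exact: leq_trunc_div.
Unshelve. all: by end_near. Qed.

(** * Expected acquisition numbers of the two models *)

Section AcquisitionMeans.
Variable R : realType.

Definition acquisition n (w : weighting (path_graph n)) : R :=
  (total_acquisition w)%:R.

Lemma acquisition_ge0 n w : (0 <= @acquisition n w)%R. Proof. exact: ler0n. Qed.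

Lemma acquisition_le n w : (@acquisition n w <= n%:R)%R.
Proof. by rewrite ler_nat -[X in (_ <= X)%N]card_ord total_acquisition_card. Qed.

Lemma acquisition_add_chip n (v : path_graph n) w :
  (`|acquisition (add_chip v w) - acquisition w| <= 3)%R.
Proof.
have off : {in predC1 v, add_chip v w =1 w}.
  by move=> x /negbTE xv; rewrite ffunE xv.
have off' : {in predC1 v, w =1 add_chip v w} by move=> x /off.
have := total_acquisition_lipschitz (@path_graph_deg2 n) off.
have := total_acquisition_lipschitz (@path_graph_deg2 n) off'.
rewrite -!(ler_nat R) !natrD /acquisition ler_norml; lra.
Qed.

(** The Poisson expectation on [n.+1] vertices as a series. It depends on no probability space, so
    values for different [n] can be compared although the models may live on unrelated spaces. *)
Definition poisson_acquisition n : \bar R :=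
  \sum_(m <oo) (poisson_pmf n.+1%:R m * chip_mean (@acquisition n.+1) m)%:E.

Let pmf_ge0 n m : (0 <= poisson_pmf n.+1%:R m * chip_mean (@acquisition n.+1) m)%R.
Proof. by rewrite mulr_ge0 ?poisson_pmf_ge0 ?chip_mean_ge0. Qed.

Lemma poisson_acquisition_ge0 n : 0 <= poisson_acquisition n.
Proof. by apply: nneseries_ge0 => m _ _; rewrite lee_fin. Qed.

Lemma poisson_acquisition_le n : poisson_acquisition n <= n.+1%:R%:E.
Proof.
rewrite -(@poisson_pmf_sum_cst R n.+1%:R) ?ltr0n //.
apply: lee_nneseries => m *; first by rewrite lee_fin.
rewrite lee_fin ler_wpM2l ?poisson_pmf_ge0 // ler_chip_mean //.
exact: acquisition_le.
Qed.

Lemma poisson_acquisition_fin n : poisson_acquisition n \is a fin_num.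
Proof.
rewrite ge0_fin_numE ?poisson_acquisition_ge0 //.
by rewrite (le_lt_trans (poisson_acquisition_le n)) ?ltry.
Qed.

Lemma poisson_acquisitionE d (T : measurableType d) (P : probability T R) n
    (W : 'I_n.+1 -> {RV P >-> nat}) :
  mutually_independent W -> (forall i, poisson_distributed 1%R (W i)) ->
  \int[P]_t (acquisition ([ffun v => W v t] : weighting (path_graph n.+1)))%:E =
  poisson_acquisition n.
Proof. by move=> indep pois; exact: poissonization indep pois _ _. Qed.

(** One Poisson family on the long path suffices: its restrictions to the two blocks are again
    independent Poisson families, and the concatenation bound is integrated. With the index one
    below the number of vertices, [m + n.+1] stands for [m.+1 + n.+1] vertices. *)
Lemma poisson_acquisition_sub d (T : measurableType d) (P : probability T R) m n
    (W : 'I_(m.+1 + n.+1) -> {RV P >-> nat}) :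
  mutually_independent W -> (forall i, poisson_distributed 1%R (W i)) ->
  poisson_acquisition (m + n.+1) <= poisson_acquisition m + poisson_acquisition n.
Proof.
move=> indep pois.
have indepl := mutually_independent_comp (@lshift_inj m.+1 n.+1) indep.
have indepr := mutually_independent_comp (@rshift_inj m.+1 n.+1) indep.
have poisl i : poisson_distributed 1%R ((W \o @lshift m.+1 n.+1) i) by exact: pois.
have poisr i : poisson_distributed 1%R ((W \o @rshift m.+1 n.+1) i) by exact: pois.
have meas k (Y : 'I_k.+1 -> {RV P >-> nat}) : measurable_fun setT
    (fun t => (acquisition ([ffun v => Y v t] : weighting (path_graph k.+1)))%:E).
  apply/measurable_EFinP => _ B mB; rewrite setTI.
  exact: (measurable_poisson_weighting Y (fun w => B (acquisition w))).
rewrite -(@poisson_acquisitionE _ _ P (m + n.+1) W) //.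
rewrite -(poisson_acquisitionE indepl) // -(poisson_acquisitionE indepr) //.
rewrite -ge0_integralD //; first last.
- by move=> t _; rewrite lee_fin acquisition_ge0.
- by move=> t _; rewrite lee_fin acquisition_ge0.
apply: ge0_le_integral => //.
- by move=> t _; rewrite lee_fin acquisition_ge0.
- by apply: emeasurable_funD; exact: meas.
move=> t _; rewrite -EFinD lee_fin -natrD ler_nat.
apply: leq_trans (total_acquisition_path_cat (m := m.+1) (n := n.+1) _) _.
by apply: eq_leq; congr addn; congr total_acquisition; apply/ffunP => v;
  rewrite !ffunE.
Qed.

Lemma chip_mean_poisson_acquisition n :
  (`|chip_mean (@acquisition n.+1) n.+1 - fine (poisson_acquisition n)| <=
   3 * Num.sqrt n.+1%:R)%R.
Proof.
have [] := @poisson_pmf_lipschitz R (chip_mean (@acquisition n.+1)) 3 _ _ _ n.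
- by move=> m; exact: chip_mean_ge0.
- by [].
- by move=> m k; apply: chip_mean_lipschitz => v w; exact: acquisition_add_chip.
rewrite -/(poisson_acquisition n) -(fineK (poisson_acquisition_fin n)).
rewrite -EFinD !lee_fin ler_norml; lra.
Qed.

End AcquisitionMeans.

Theorem theorem3p7 (R : realType)
  (d : nat -> measure_display) (T : forall n, measurableType (d n))
  (P : forall n, probability (T n) R)
  (X : forall n, 'I_n.+1 -> {RV P n >-> 'I_n.+1})
  (d' : nat -> measure_display) (T' : forall n, measurableType (d' n))
  (P' : forall n, probability (T' n) R)
  (W : forall n, 'I_n.+1 -> {RV P' n >-> nat})
  (X_indep : forall n, mutually_independent (X n))
  (X_unif : forall n i, uniformly_distributed (X n i))
  (W_indep : forall n, mutually_independent (W n))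
  (W_poisson : forall n i, poisson_distributed 1%R (W n i)) :
  exists l : R,
    (expected_acquisition (P n) (G := path_graph n.+1)
       (fun t => chip_weighting (fun i => X n i t)) * (n.+1%:R^-1)%:E
       @[n --> \oo] --> l%:E) /\
    (expected_acquisition (P' n) (G := path_graph n.+1)
       (fun t => [ffun v => W n v t]) * (n.+1%:R^-1)%:E
       @[n --> \oo] --> l%:E).
Proof.
pose a n : R := fine (poisson_acquisition R n).
have aE n : (a n)%:E = poisson_acquisition R n by rewrite fineK ?poisson_acquisition_fin.
(* Reindexing by the number of vertices, with value 0 for the empty path, makes the sequence
   subadditive in its index. *)
pose u n : R := if n is k.+1 then a k else 0%R.
have [l al] : exists l : R, (a n / n.+1%:R)%R @[n --> \oo] --> l.
  apply: (@fekete R u).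
    case=> [|n] /=; first by rewrite lexx.
    by rewrite -!lee_fin aE poisson_acquisition_ge0 poisson_acquisition_le.
  case=> [|m] [|n]; rewrite ?addn0 ?add0n ?addr0 ?add0r //.
  by rewrite addSn -lee_fin EFinD !aE (poisson_acquisition_sub (W_indep _) (W_poisson _)).
pose c n : R := chip_mean (@acquisition R n.+1) n.+1.
have ca : (c n / n.+1%:R - a n / n.+1%:R)%R @[n --> \oo] --> (0 : R)%R.
  apply: norm_cvg0.
  (* [harmonic n] is [1 / n.+1], so this is the bound [3 * sqrt n.+1] divided by [n.+1]. *)
  have hlim : ((3 * Num.sqrt (harmonic n)) : R)%R @[n --> \oo] --> (0 : R)%R.
    rewrite -[X in _ --> X](mulr0 3%R) -[in X in _ --> X](sqrtr0 R).
    apply: cvgM; first exact: cvg_cst.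
    by apply: continuous_cvg; [exact: sqrt_continuous | exact: cvg_harmonic].
  apply: (squeeze_cvgr _ (cvg_cst 0%R) hlim); apply: nearW => n.
  rewrite normr_ge0 -mulrBl normrM [X in (_ * X)%R]ger0_norm ?invr_ge0 //=.
  rewrite ler_pdivrMr // (le_trans (chip_mean_poisson_acquisition _ _)) //.
  rewrite -mulrA ler_wpM2l // sqrtrV // -[X in (_ <= _ * X)%R]sqr_sqrtr //.
  by rewrite expr2 mulKf // sqrtr_eq0 -ltNge.
exists l; split.
  rewrite (_ : (fun n => _) = EFin \o (fun n => c n / n.+1%:R)%R); last first.
    apply/funext => n /=; rewrite EFinM /expected_acquisition unlock;
      congr (_ * _).
    exact: uniform_chips_mean (X_indep n) (X_unif n) (@acquisition_ge0 R n.+1).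
  apply: cvg_EFin; first by apply: nearW.
  rewrite (_ : _ \o _ = (fun n => (c n / n.+1%:R - a n / n.+1%:R) + a n / n.+1%:R)%R).
    by rewrite -[l]add0r; exact: cvgD.
  by apply/funext => n /=; rewrite subrK.
rewrite (_ : (fun n => _) = EFin \o (fun n => a n / n.+1%:R)%R); last first.
  apply/funext => n /=; rewrite EFinM aE /expected_acquisition unlock;
    congr (_ * _).
  exact: poisson_acquisitionE (W_indep n) (W_poisson n).
by apply: cvg_EFin; first exact: nearW.
Qed.
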